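(* Let $T>0$, let $W$ be a (standard, real) Brownian motion on $[0,T]$, and consider the stochastic differential equation $$X_t=\int_0^t\sqrt{|X_s|}\,ds+|W_t|,\qquad t\in[0,T].$$ Then this equation has a unique path-by-path solution, for almost all paths of $W$.
   Context: Path-by-path solution: the equation is solved $\omega$-by-$\omega$, i.e. for each fixed continuous sample path $\omega_\cdot$ of $W$ one considers the deterministic equation $x_t=\int_0^t\sqrt{|x_s|}\,ds+|\omega_t|$, $t\in[0,T]$, for a continuous unknown $x\colon[0,T]\to\mathbb R$ (no adaptedness to the filtration of the noise is required). The assertion means that for almost all sample paths $\omega$ of $W$ this deterministic equation has exactly one continuous solution on $[0,T]$. *)

(* Defs.v *)
From HB Require Import structures.
From mathcomp Require Import all_boot all_order all_algebra.
From mathcomp Require Import all_classical all_reals all_analysis.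
From mathcomp Require Import measurable_realfun.

Set Implicit Arguments.
Unset Strict Implicit.
Unset Printing Implicit Defensive.

Import Order.TTheory GRing.Theory Num.Theory.
Import numFieldNormedType.Exports.

Local Open Scope classical_set_scope.
Local Open Scope ring_scope.

(* Taking some of the [B i] equal to [setT] gives the product rule for every
   subfamily. *)
Definition mutually_independent (d : measure_display) (Omega : measurableType d)
    (R : realType) (P : probability Omega R) (n : nat)
    (X : 'I_n -> {RV P >-> R}) : Prop :=
  forall B : 'I_n -> set R, (forall i, measurable (B i)) ->
    P (\bigcap_(i in [set: 'I_n]) (X i @^-1` B i)) =
    (\prod_(i < n) P (X i @^-1` B i))%E.

(* The process is indexed by all of [R], but only its values at the times in
   [0, T] are constrained. The second parameter of [normal_prob] is the standard
   deviation, so the increments have variance [t - s]. *)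
Record brownian_motion (d : measure_display) (Omega : measurableType d)
    (R : realType) (P : probability Omega R) (T : R)
    (W : R -> {RV P >-> R}) : Prop := BrownianMotion {
  brownian_start : {ae P, forall omega, W 0 omega = 0} ;
  brownian_indep : forall (n : nat) (t : 'I_n.+1 -> R),
    (forall i, t i \in `[0, T]) ->
    {homo t : i j / (i < j)%N >-> i < j} ->
    mutually_independent
      (fun i : 'I_n => (W (t (lift ord0 i)) \- W (t (widen_ord (leqnSn n) i)))%R
         : {RV P >-> R}) ;
  brownian_normal : forall s t : R, 0 <= s -> s < t -> t <= T ->
    forall B : set R, measurable B ->
    distribution P (W t \- W s)%R B = normal_prob 0 (Num.sqrt (t - s)) B ;
  brownian_continuous : {ae P, forall omega,
    {within `[0, T], continuous (fun t => W t omega)}}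
}.

(* Continuous solution on [0, T] of x_t = int_0^t sqrt |x_s| ds + |w_t| for a
   fixed path [w]; the values of [x] outside [0, T] are irrelevant. *)
Definition path_solution (R : realType) (T : R) (w x : R -> R) : Prop :=
  {within `[0, T], continuous x} /\
  forall t : R, t \in `[0, T] ->
    x t = \int[lebesgue_measure]_(s in `[0, t]) Num.sqrt `|x s| + `|w t|.

Definition unique_path_solution (R : realType) (T : R) (w : R -> R) : Prop :=
  exists2 x : R -> R, path_solution T w x &
    forall y : R -> R, path_solution T w y -> {in `[0, T], y =1 x}.

(* Main.v *)
Require Import Defs.
From HB Require Import structures.
From mathcomp Require Import all_boot all_order all_algebra.
From mathcomp Require Import all_classical all_reals all_analysis.
From mathcomp Require Import measurable_realfun ring lra.

Set Implicit Arguments.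
Unset Strict Implicit.
Unset Printing Implicit Defensive.

Import Order.TTheory GRing.Theory Num.Theory.
Import numFieldNormedType.Exports.

Local Open Scope classical_set_scope.
Local Open Scope ring_scope.

(** Write I_t for the integral of sqrt |x_s| over [0, t], so that a solution
    is x = I + |w|, and in particular x >= I >= 0. The square root fails to be
    Lipschitz only at 0, and the noise |w| pushes every solution away from 0
    fast enough.

    Uniqueness. Almost surely w_0 = 0 and w is nonzero at times arbitrarily
    close to 0, because w_t - w_0 has a Gaussian, hence atomless, law for each
    of the times t = T / (n + 1). Then I is positive on ]0, T]
    ([drift_gt0]), and I' = sqrt x >= sqrt I forces sqrt I_t >= t / 2
    ([sqrt_drift_ge]). So the sum of the square roots of two solutions x, y is
    at least t, and the difference u of their integrals satisfies
    |u'| = |u| / (sqrt x + sqrt y) <= |u| / t. This is the critical case of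
    Nagumo's criterion: (u / t)^2 is nonincreasing
    ([ratio_nonincreasing]), and it tends to 0 at 0 because
    the integrals of both solutions are o(t) ([drift_small]). Hence u = 0
    ([solution_unique]).

    Existence holds for every continuous path. The map sending x to I + |w| is
    nondecreasing on nonnegative functions, so its iterates from |w| increase;
    they stay below a constant because the square root is sublinear
    ([picard_bound]), and dominated convergence identifies their pointwise
    limit as a fixed point ([solution_exists]). *)

(** * The integral term of the equation *)

Definition drift (R : realType) (x : R -> R) (t : R) : R :=
  \int[lebesgue_measure]_(s in `[0, t]) Num.sqrt `|x s|.

Lemma sqrt_norm_continuous (R : realType) (A : set R) (x : R -> R) :
  {within A, continuous x} ->
  {within A, continuous (fun s => Num.sqrt `|x s|)}.
Proof.
move=> cx.
apply: (@within_continuous_comp _ _ _ A x (fun r => Num.sqrt `|r|)) => // r _.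
by apply: continuous_comp; [exact: norm_continuous | exact: sqrt_continuous].
Qed.

Lemma sqrt_norm_integrable (R : realType) (T : R) (x : R -> R) :
  {within `[0, T], continuous x} ->
  lebesgue_measure.-integrable `[0, T] (EFin \o (fun s => Num.sqrt `|x s|)).
Proof.
move=> /sqrt_norm_continuous cx.
by apply: continuous_compact_integrable => //; exact: segment_compact.
Qed.

Lemma within_continuous_itv0 (R : realType) (T t : R) (x : R -> R) : t <= T ->
  {within `[0, T], continuous x} -> {within `[0, t], continuous x}.
Proof.
by move=> tT; apply/continuous_subspaceW/subset_itvl; rewrite bnd_simp.
Qed.

Lemma drift_ge0 (R : realType) (x : R -> R) (t : R) : 0 <= drift x t.
Proof. by apply: Rintegral_ge0 => s _; exact: sqrtr_ge0. Qed.

Lemma drift_continuous (R : realType) (T : R) (x : R -> R) : 0 <= T ->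
  lebesgue_measure.-integrable `[0, T] (EFin \o (fun s => Num.sqrt `|x s|)) ->
  {within `[0, T], continuous (drift x)}.
Proof. exact: parameterized_integral_continuous. Qed.

Lemma is_derive_drift (R : realType) (T : R) (x : R -> R) (s : R) :
  {within `[0, T], continuous x} -> s \in `]0, T[ ->
  is_derive s 1 (drift x) (Num.sqrt `|x s|).
Proof.
move=> cx sT; have [s0 sT'] : 0 < s /\ s < T.
  by move: sT; rewrite in_itv/= => /andP.
have T0 := lt_trans s0 sT'.
have [D E] := continuous_FTC1_closed sT' (sqrt_norm_integrable cx) s0
  (within_continuous_continuous T0 (sqrt_norm_continuous cx) sT).
by rewrite -E derive1E; exact/derivableP.
Qed.

Lemma le_drift_fun (R : realType) (t : R) (x y : R -> R) :
  {within `[0, t], continuous x} -> {within `[0, t], continuous y} ->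
  (forall s, s \in `[0, t] -> `|x s| <= `|y s|) -> drift x t <= drift y t.
Proof.
move=> cx cy xy; apply: le_Rintegral => //; [exact: sqrt_norm_integrable..|].
by move=> s st; apply/ler_wsqrtr/xy.
Qed.

Lemma drift_le_cst (R : realType) (t c : R) (x : R -> R) : 0 <= t ->
  {within `[0, t], continuous x} ->
  (forall s, s \in `[0, t] -> `|x s| <= c) -> drift x t <= t * Num.sqrt c.
Proof.
move=> t0 cx xc.
have c0 : 0 <= c.
  by apply: le_trans (normr_ge0 (x 0)) (xc 0 _); rewrite in_itv/= lexx.
have -> : t * Num.sqrt c = drift (fun _ => c) t.
  rewrite /drift Rintegral_cst//= lebesgue_measure_itv/= lte_fin ger0_norm//.
  by case: ltgtP t0 => //= [_ _|<- _]; rewrite ?subr0 ?mulr0 ?mul0r// mulrC.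
apply: le_drift_fun => //.
  by apply: continuous_subspaceT => r; exact: cvg_cst.
by move=> s st; rewrite (ger0_norm c0) xc.
Qed.

Lemma drift_nondecreasing (R : realType) (T : R) (x : R -> R) :
  {within `[0, T], continuous x} ->
  {in `[0, T] &, {homo drift x : s t / s <= t}}.
Proof.
move=> cx; have [T0|T0] := leP 0 T; last first.
  by move=> s t; rewrite in_itv/= => /andP[s0 /(le_trans s0)]; rewrite leNgt T0.
apply: ger0_derive1_le_cc.
- by move=> s /(is_derive_drift cx)[].
- move=> s /(is_derive_drift cx)[_]; rewrite derive1E => ->.
  exact: sqrtr_ge0.
- exact/drift_continuous/sqrt_norm_integrable.
Qed.

(** * Growth of solutions and uniqueness *)

Section uniqueness.
Variables (R : realType) (T : R) (w : R -> R).
Hypothesis w_nonzero : forall e, 0 < e -> exists2 s, s \in `]0, e[ & w s != 0.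

Section single_solution.
Variable x : R -> R.
Hypothesis solx : path_solution T w x.

Let cx : {within `[0, T], continuous x} := solx.1.

Lemma solution_eq t : t \in `[0, T] -> x t = drift x t + `|w t|.
Proof. exact: solx.2. Qed.

Lemma solution_ge_drift t : t \in `[0, T] -> drift x t <= x t.
Proof. by move=> /solution_eq ->; rewrite lerDl. Qed.

Lemma solution_norm t : t \in `[0, T] -> `|x t| = x t.
Proof.
move=> tT; rewrite ger0_norm//.
exact: le_trans (drift_ge0 _ _) (solution_ge_drift tT).
Qed.

(** If the integral vanished at t, it would vanish on [0, t] by monotonicity;
    but its derivative is positive wherever w is nonzero. *)
Lemma drift_gt0 t : t \in `]0, T] -> 0 < drift x t.
Proof.
rewrite in_itv/= => /andP[t0 tT].
have [s /[!in_itv]/= /andP[s0 st] ws] := w_nonzero t0.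
have sT : s \in `]0, T[ by rewrite in_itv/= s0 (lt_le_trans st).
have xs : 0 < Num.sqrt `|x s|.
  have s'T := subset_itv_oo_cc sT.
  rewrite sqrtr_gt0 solution_norm// solution_eq//.
  by rewrite ltr_wpDl ?drift_ge0// normr_gt0.
rewrite lt_neqAle drift_ge0 andbT eq_sym; apply/eqP => It0.
have I0 r : r \in `]0, t[ -> drift x r = 0.
  rewrite in_itv/= => /andP[r0 rt]; apply/le_anti; rewrite drift_ge0 andbT -It0.
  apply: (drift_nondecreasing cx); last exact: ltW.
  - by rewrite in_itv/= (ltW r0) (le_trans (ltW rt)).
  - by rewrite in_itv/= (ltW t0).
have : is_derive s 1 (drift x) 0.
  have st' : s \in `]0, t[ by rewrite in_itv/= s0.
  apply: (@near_eq_is_derive _ R^o R^o (cst 0)).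
    by near=> r; rewrite I0//; near: r; exact: near_in_itvoo.
move=> [_ E]; move: xs.
by have [_ <-] := is_derive_drift cx sT; rewrite E ltxx.
Unshelve. all: by end_near. Qed.

(** The derivative sqrt x / (2 sqrt I) of sqrt I is at least 1/2 as x >= I.
    Since sqrt I is differentiable only where I > 0, the comparison starts at a
    small s > 0. *)
Lemma sqrt_drift_ge t : t \in `]0, T] -> t / 2 <= Num.sqrt (drift x t).
Proof.
rewrite in_itv/= => /andP[t0 tT].
(* Integrating the growth rate 1/2 from s loses s / 2 < e. *)
apply/ler_addgt0Pr => e e0.
pose s := Num.min e (t / 2).
have s0 : 0 < s by rewrite lt_min e0 divr_gt0.
have se : s <= e by rewrite ge_min lexx.
have st : s < t by rewrite gt_min; apply/orP; right; lra.
have drv r : r \in `]s, t[ ->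
    is_derive r 1 (fun r => Num.sqrt (drift x r) - r / 2)
      ((2 * Num.sqrt (drift x r))^-1 * Num.sqrt `|x r| - 1 / 2).
  rewrite in_itv/= => /andP[sr rt].
  have rT : r \in `]0, T[ by rewrite in_itv/= (lt_trans s0 sr) (lt_le_trans rt).
  have I0 : 0 < drift x r by apply/drift_gt0/subset_itv_oo_oc.
  have D1 := is_derive1_comp (is_derive1_sqrt I0) (is_derive_drift cx rT).
  apply: is_deriveB => //; apply: is_derive_eq.
  by rewrite !scaler0 add0r div1r /GRing.scale/= mulr1.
have nd : {in `[s, t] &,
    {homo (fun r => Num.sqrt (drift x r) - r / 2) : a b / a <= b}}.
  apply: ger0_derive1_le_cc.
  - by move=> r /drv[].
  - move=> r rst; have [_] := drv _ rst; rewrite derive1E => ->.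
    move: rst; rewrite in_itv/= => /andP[sr rt].
    have rT : r \in `]0, T].
      by rewrite in_itv/= (lt_trans s0 sr) (le_trans (ltW rt)).
    have I0 := drift_gt0 rT.
    have S0 : 0 < Num.sqrt (drift x r) by rewrite sqrtr_gt0.
    rewrite subr_ge0 invfM mul1r -mulrA ler_pMr ?invr_gt0//.
    rewrite mulrC ler_pdivlMr// mul1r; apply: ler_wsqrtr.
    by rewrite solution_norm ?solution_ge_drift//; exact: subset_itv_oc_cc.
  - apply: within_continuousB.
    + apply: (@within_continuous_comp _ _ _ _ (drift x) Num.sqrt) => [r _|].
        exact: sqrt_continuous.
      have st0T : `[s, t] `<=` `[0, T].
        by apply: subset_itv; rewrite bnd_simp// ltW.
      apply/(continuous_subspaceW st0T)/drift_continuous => //; last first.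
        exact: sqrt_norm_integrable.
      exact: ltW (lt_le_trans t0 tT).
    + by apply: continuous_subspaceT => r; exact: mulrr_continuous.
have := nd s t; rewrite !in_itv/= !lexx (ltW st) => /(_ isT isT isT).
have := sqrtr_ge0 (drift x s); lra.
Qed.

Lemma sqrt_solution_ge t : t \in `]0, T] -> t / 2 <= Num.sqrt (x t).
Proof.
move=> tT; apply: le_trans (sqrt_drift_ge tT) _.
by apply/ler_wsqrtr/solution_ge_drift/subset_itv_oc_cc.
Qed.

(** As x is continuous with x_0 = 0, the integrand sqrt x is eventually below
    any e > 0. *)
Lemma drift_small e : 0 < T -> w 0 = 0 -> 0 < e ->
  exists2 d, 0 < d &
    forall s, s \in `[0, T] -> s < d -> drift x s <= s * e.
Proof.
move=> T0 w0 e0.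
have x0 : x 0 = 0.
  rewrite solution_eq ?in_itv/= ?lexx ?ltW// w0 normr0 addr0.
  by rewrite /drift set_itv1 Rintegral_set1.
have /continuous_within_itvP : {within `[0, T], continuous x} by [].
move=> /(_ T0)[_ + _]; rewrite x0 => /cvgrPdist_lt /(_ (e ^+ 2)).
rewrite exprn_gt0// => /(_ isT) [d /= d0 near0].
exists d => // s; rewrite in_itv/= => /andP[s0 sT] sd.
have -> : e = Num.sqrt (e ^+ 2) by rewrite sqrtr_sqr gtr0_norm.
apply: drift_le_cst => //; first exact: within_continuous_itv0 cx.
move=> r; rewrite in_itv/= le_eqVlt => /andP[/predU1P[<- _|r0 rs]].
  by rewrite x0 normr0 exprn_ge0// ltW.
have rd : `|0 - r| < d by rewrite sub0r normrN gtr0_norm// (le_lt_trans rs).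
by have /= := near0 r rd r0; rewrite sub0r normrN => /ltW.
Qed.

End single_solution.

Variables (x y : R -> R).
Hypotheses (solx : path_solution T w x) (soly : path_solution T w y).

Let ratio r := ((drift x r - drift y r) / r) ^+ 2.

(** With a = sqrt x, b = sqrt y, the equation gives u = a^2 - b^2 and
    u' = a - b, so the derivative of (u / r)^2 is
    - 2 (a - b)^2 (a + b) (a + b - r) / r^3, and a + b >= r by
    [sqrt_solution_ge]. *)
Lemma ratio_nonincreasing s t : 0 < s -> s <= t -> t <= T -> ratio t <= ratio s.
Proof.
move=> s0 st tT.
have [cx cy] := (solx.1, soly.1).
have drv r : r \in `]s, t[ -> is_derive r 1 ratio
   (2 * ((drift x r - drift y r) / r) *
     ((Num.sqrt (x r) - Num.sqrt (y r)) / r -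
      (drift x r - drift y r) / r ^+ 2)).
  rewrite in_itv/= => /andP[sr rt].
  have rT : r \in `]0, T[ by rewrite in_itv/= (lt_trans s0 sr) (lt_le_trans rt).
  have r0 : r != 0 by rewrite gt_eqF// (lt_trans s0 sr).
  have := is_derive_drift cx rT.
  rewrite (solution_norm solx) ?subset_itv_oo_cc// => Dx.
  have := is_derive_drift cy rT.
  rewrite (solution_norm soly) ?subset_itv_oo_cc// => Dy.
  have DV := @is_deriveV _ id r _ _ r0 (is_derive_id r 1).
  have := is_deriveX 2 (is_deriveM (is_deriveB Dx Dy) DV).
  move=> D; apply: (is_derive_eq D).
  rewrite -[LHS]/((2 * ((drift x r - drift y r) / r) ^+ 1) *
    ((drift x r - drift y r) * (- r ^- 2 * 1) +
      r^-1 * (Num.sqrt (x r) - Num.sqrt (y r)))).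
  by rewrite expr1 mulr1; congr (_ * _); rewrite mulrN addrC mulrC.
apply: (@ler0_derive1_le_cc _ ratio s t) => //; rewrite ?in_itv/= ?lexx ?st//.
- by move=> r /drv[].
- move=> r rst; have [_] := drv _ rst; rewrite derive1E => ->.
  move: rst; rewrite in_itv/= => /andP[sr rt].
  have r0 := lt_trans s0 sr.
  have rT : r \in `]0, T] by rewrite in_itv/= r0 (le_trans (ltW rt)).
  have rT' := subset_itv_oc_cc rT.
  have ax := sqrt_solution_ge solx rT.
  have ay := sqrt_solution_ge soly rT.
  have sq z : path_solution T w z -> Num.sqrt (z r) ^+ 2 = drift z r + `|w r|.
    by move=> sz; rewrite sqr_sqrtr ?(solution_eq sz)// addr_ge0// drift_ge0.
  have -> : drift x r - drift y r = Num.sqrt (x r) ^+ 2 - Num.sqrt (y r) ^+ 2.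
    by rewrite !sq//; lra.
  move: ax ay; set a := Num.sqrt (x r); set b := Num.sqrt (y r) => ax ay.
  have -> : 2 * ((a ^+ 2 - b ^+ 2) / r) *
      ((a - b) / r - (a ^+ 2 - b ^+ 2) / r ^+ 2) =
    - (2 * ((a - b) ^+ 2 * (a + b) * (a + b - r)) / r ^+ 3).
    by field; rewrite gt_eqF.
  rewrite oppr_le0; apply: divr_ge0; last exact/exprn_ge0/ltW.
  apply: mulr_ge0 => //; apply: mulr_ge0; last lra.
  by apply: mulr_ge0; [exact: sqr_ge0|lra].
- have cd z : path_solution T w z -> {within `[s, t], continuous (drift z)}.
    move=> [cz _]; have sub : `[s, t] `<=` `[0, T].
      by apply: subset_itv; rewrite bnd_simp// ltW.
    apply/(continuous_subspaceW sub)/drift_continuous; last first.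
      exact: sqrt_norm_integrable.
    exact: le_trans (ltW s0) (le_trans st tT).
  apply: (@within_continuous_comp _ _ _ _
    (fun r => (drift x r - drift y r) / r) (fun z => z ^+ 2)) => [r _|].
    exact: exprn_continuous.
  move=> r.
  apply: (@continuousM _ (subspace `[s, t]) (drift x - drift y) GRing.inv).
    exact: within_continuousB (cd _ solx) (cd _ soly) r.
  apply: (@derivable_within_continuous _ _ GRing.inv `[s, t]) => z.
  rewrite in_itv/= => /andP[sz _].
  have z0 : z != 0 by rewrite gt_eqF// (lt_le_trans s0).
  by have [] := @is_deriveV _ id z _ _ z0 (is_derive_id z 1).
Qed.

Lemma solution_unique : 0 < T -> w 0 = 0 -> {in `[0, T], x =1 y}.
Proof.
move=> T0 w0 t tT.
rewrite (solution_eq solx)// (solution_eq soly)//; congr (_ + _).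
move: tT; rewrite in_itv/= le_eqVlt => /andP[/predU1P[<- _|t0 tT]].
  by rewrite /drift set_itv1 !Rintegral_set1.
suff : ratio t <= 0.
  rewrite le_eqVlt ltNge sqr_ge0 orbF sqrf_eq0 mulf_eq0 invr_eq0.
  by rewrite (gt_eqF t0) orbF subr_eq0 => /eqP.
apply/ler_addgt0Pr => e e0; rewrite add0r.
have se0 : 0 < Num.sqrt e by rewrite sqrtr_gt0.
have [dx dx0 hx] := drift_small solx T0 w0 se0.
have [dy dy0 hy] := drift_small soly T0 w0 se0.
pose s := Num.min t (Num.min dx dy / 2).
have d0 : 0 < Num.min dx dy by rewrite lt_min dx0.
have s0 : 0 < s by rewrite lt_min t0 divr_gt0.
have st : s <= t by rewrite ge_min lexx.
have sd : s < Num.min dx dy by rewrite gt_min; apply/orP; right; lra.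
have sT : s \in `[0, T] by rewrite in_itv/= ltW//= (le_trans st).
move: sd; rewrite lt_min => /andP[/(hx _ sT) Ix /(hy _ sT) Iy].
apply: le_trans (ratio_nonincreasing s0 st tT) _.
have Ix0 := drift_ge0 x s; have Iy0 := drift_ge0 y s.
rewrite -[e]sqr_sqrtr ?(ltW e0)// /ratio -(real_normK (num_real (_ / s))).
rewrite ler_sqr ?nnegrE ?normr_ge0 ?sqrtr_ge0// normrM normfV (gtr0_norm s0).
by rewrite ler_pdivrMr// ler_norml; lra.
Qed.
End uniqueness.

(** * Existence by monotone iteration *)

Lemma drift_dominated_convergence (R : realType) (t c : R)
    (f : nat -> R -> R) (g : R -> R) :
  (forall n, {within `[0, t], continuous (f n)}) ->
  (forall n s, s \in `[0, t] -> `|f n s| <= c) ->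
  (forall s, s \in `[0, t] -> f n s @[n --> \oo] --> g s) ->
  lebesgue_measure.-integrable `[0, t] (EFin \o (fun s => Num.sqrt `|g s|)) /\
  drift (f n) t @[n --> \oo] --> drift g t.
Proof.
move=> cf fc fg; pose F n s : \bar R := (Num.sqrt `|f n s|)%:E.
have mF n : measurable_fun `[0, t] (F n).
  exact: measurable_int (sqrt_norm_integrable (cf n)).
have Fg s : s \in `[0, t] -> F n s @[n --> \oo] --> (Num.sqrt `|g s|)%:E.
  move=> st; apply: cvg_EFin; first exact: nearW.
  apply: (@continuous_cvg _ _ _ _ _ _ Num.sqrt); first exact: sqrt_continuous.
  exact: cvg_norm (fg s st).
have ic : lebesgue_measure.-integrable `[0, t] (EFin \o cst (Num.sqrt c)).
  apply: continuous_compact_integrable; first exact: segment_compact.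
  by apply: continuous_subspaceT => r; exact: cvg_cst.
have [||ig _ cvF] := @dominated_convergence _ _ R lebesgue_measure
  [set` `[0, t]] (measurable_itv _) F (fun s => (Num.sqrt `|g s|)%:E) _ mF
  (emeasurable_fun_cvg _ _ mF Fg) _ ic.
- exact: aeW.
- apply: aeW => s n st; rewrite /= /F lee_fin ger0_norm ?sqrtr_ge0//.
  exact/ler_wsqrtr/fc.
split=> //; apply: fine_cvg; rewrite fineK//.
exact: integrable_fin_num.
Unshelve. all: by end_near. Qed.

Section existence.
Variables (R : realType) (T : R) (w : R -> R).
Hypothesis cw : {within `[0, T], continuous w}.

Definition picard (n : nat) : R -> R :=
  iter n (fun x t => drift x t + `|w t|) (fun t => `|w t|).

Lemma norm_path_continuous : {within `[0, T], continuous (fun t => `|w t|)}.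
Proof.
apply: (@within_continuous_comp _ _ _ _ w Num.norm) => // r _.
exact: norm_continuous.
Qed.

Lemma picard_continuous n : 0 <= T -> {within `[0, T], continuous (picard n)}.
Proof.
move=> T0; elim: n => [|n IH]; first exact: norm_path_continuous.
apply: within_continuousD; last exact: norm_path_continuous.
exact/drift_continuous/sqrt_norm_integrable.
Qed.

Lemma picard_ge0 n t : 0 <= picard n t.
Proof. by case: n => [|n]//=; rewrite addr_ge0// drift_ge0. Qed.

Lemma picard_leS n t : t \in `[0, T] -> picard n t <= picard n.+1 t.
Proof.
elim: n t => [t _|n IH t tT]; first by rewrite /= lerDr drift_ge0.
have /andP[t0 tT'] : 0 <= t <= T by [].
have T0 := le_trans t0 tT'.
rewrite /= lerD2r; apply: le_drift_fun.
- exact: within_continuous_itv0 (picard_continuous T0).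
- exact: (within_continuous_itv0 tT' (@picard_continuous n.+1 T0)).
- move=> s; rewrite in_itv/= => /andP[s0 st].
  rewrite -[drift _ _ + _]/(picard n.+1 s) !ger0_norm ?picard_ge0//; apply: IH.
  by rewrite in_itv/= s0 (le_trans st).
Qed.

(** With M = (T + m + 1)^2 one has T sqrt M + m <= M, so the bound M is
    preserved by each iteration. *)
Lemma picard_bound m n t : (forall s, s \in `[0, T] -> `|w s| <= m) ->
  t \in `[0, T] -> picard n t <= (T + m + 1) ^+ 2.
Proof.
move=> wm; elim: n t => [|n IH] t tT; have /andP[t0 tT'] : 0 <= t <= T by [].
  have := wm _ tT; rewrite /=; have := normr_ge0 (w t); nra.
have T0 := le_trans t0 tT'.
have m0 := le_trans (normr_ge0 _) (wm _ tT).
have cp : {within `[0, t], continuous (picard n)}.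
  exact: within_continuous_itv0 (picard_continuous T0).
have := @drift_le_cst _ t ((T + m + 1) ^+ 2) _ t0 cp.
have -> : Num.sqrt ((T + m + 1) ^+ 2) = T + m + 1.
  by rewrite sqrtr_sqr ger0_norm//; lra.
move=> H; have {}H : drift (picard n) t <= t * (T + m + 1).
  apply: H => s; rewrite in_itv/= => /andP[s0 st].
  by rewrite ger0_norm ?picard_ge0// IH// in_itv/= s0 (le_trans st).
rewrite /=; have := wm _ tT; nra.
Qed.

Lemma solution_exists : 0 <= T -> exists x, path_solution T w x.
Proof.
move=> T0.
(* The noise is bounded by its value at its maximum point c. *)
have [c _ wc] := EVT_max T0 norm_path_continuous.
pose M := (T + `|w c| + 1) ^+ 2.
have pM n t : t \in `[0, T] -> `|picard n t| <= M.
  by move=> tT; rewrite ger0_norm ?picard_ge0//; exact: picard_bound.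
pose x t := sup (range (picard ^~ t)).
have px t : t \in `[0, T] -> picard n t @[n --> \oo] --> x t.
  move=> tT; apply: nondecreasing_cvgn.
    by apply/nondecreasing_seqP => n; exact: picard_leS.
  by exists M => _ [n _ <-]; exact: picard_bound.
have dom t : t \in `[0, T] ->
    lebesgue_measure.-integrable `[0, t] (EFin \o (fun s => Num.sqrt `|x s|)) /\
    drift (picard n) t @[n --> \oo] --> drift x t.
  rewrite in_itv/= => /andP[t0 tT].
  have sub s : s \in `[0, t] -> s \in `[0, T].
    by rewrite !in_itv/= => /andP[-> st]; exact: le_trans st tT.
  apply: (@drift_dominated_convergence _ t M).
  - by move=> n; exact: within_continuous_itv0 (picard_continuous T0).
  - by move=> n s /sub; exact: pM.
  - by move=> s /sub; exact: px.
have xE t : t \in `[0, T] -> x t = drift x t + `|w t|.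
  move=> tT; apply: (@cvg_unique _ _ (picard n.+1 t @[n --> \oo])) => //.
    by have := px t tT; rewrite -(cvg_shiftS (picard ^~ t)).
  by apply: cvgD; [exact: (dom _ tT).2 | exact: cvg_cst].
exists x; split=> //.
apply: (@subspace_eq_continuous _ _ _ (drift x + (fun t => `|w t|)) x).
  by move=> t /set_mem /= tT; rewrite xE.
apply: within_continuousD; last exact: norm_path_continuous.
by apply: drift_continuous => //; apply: (dom T _).1; rewrite in_itv/= lexx T0.
Qed.

End existence.

(** * The Brownian path near time 0 *)

Lemma normal_prob_set1 (R : realType) (m s a : R) :
  normal_prob m s [set a] = 0%E.
Proof. exact: integral_set1. Qed.

(** The increment over [0, t] has a Gaussian law, which gives no mass to 0. *)
Lemma brownian_neq_start (R : realType) (d : measure_display)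
    (Omega : measurableType d) (P : probability Omega R)
    (T : R) (W : R -> {RV P >-> R}) (t : R) :
  brownian_motion T W -> t \in `]0, T] ->
  {ae P, forall omega, W t omega != W 0 omega}.
Proof.
move=> hW; rewrite in_itv/= => /andP[t0 tT].
exists ((W t \- W 0) @^-1` [set 0]); split.
- by rewrite -[X in measurable X]setTI; exact: measurable_funP.
- have := brownian_normal hW (lexx 0) t0 tT (measurable_set1 0).
  by rewrite normal_prob_set1.
- move=> omega /= /negP; rewrite negbK => /eqP ->.
  exact: subrr.
Qed.

Theorem corollary3p6 (R : realType) (d : measure_display)
    (Omega : measurableType d) (P : probability Omega R)
    (T : R) (hT : 0 < T) (W : R -> {RV P >-> R})
    (hW : brownian_motion T W) :
  {ae P, forall omega, unique_path_solution T (fun t => W t omega)}.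
Proof.
have tn n : T * n.+1%:R^-1 \in `]0, T].
  rewrite in_itv/= mulr_gt0 ?invr_gt0//=.
  by rewrite ler_piMr ?(ltW hT)// invf_le1 ?ler1n.
have neq : {ae P, forall omega, forall n,
    W (T * n.+1%:R^-1) omega != W 0 omega}.
  by apply: ae_foralln => n; exact: brownian_neq_start hW (tn n).
apply: filterS3 (brownian_start hW) (brownian_continuous hW) neq.
move=> omega w0 cw wn.
have w_nonzero e : 0 < e -> exists2 s, s \in `]0, e[ & W s omega != 0.
  move=> e0; have /ltr_add_invr[n] : 0 < e / T by rewrite divr_gt0.
  rewrite add0r ltr_pdivlMr// mulrC => ne.
  exists (T * n.+1%:R^-1); last by rewrite -w0 wn.
  by rewrite in_itv/= mulr_gt0 ?invr_gt0.
have [x solx] := solution_exists cw (ltW hT).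
exists x => // y soly t tT.
exact: (solution_unique w_nonzero soly solx).
Qed.
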